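(* For all $n \geq 0$ and $k \geq 2$, $a_{2n+1}(132, (2k-1)(2k)(2k-3)(2k-2)\cdots 3412) = s_n(132, k(k-1)\cdots 21)$, where $(2k-1)(2k)(2k-3)(2k-2)\cdots 3412$ denotes the permutation of length $2k$ formed by concatenating the pairs $(2j-1)(2j)$ for $j = k, k-1, \dots, 1$ in this order, and $k(k-1)\cdots 21$ denotes the decreasing permutation of length $k$.
   Context: A permutation $w = w_1w_2\cdots w_n$ of length $n$ is a sequence containing each of the integers $1,\dots,n$ exactly once (for $n=0$ there is exactly one, the empty permutation). It is alternating if $w_1 < w_2 > w_3 < w_4 > \cdots$. A sequence $w = w_1\cdots w_n$ of distinct integers contains a permutation $p$ of length $m$ (a pattern) if there are indices $1 \le i_1 < \cdots < i_m \le n$ such that $w_{i_1}\cdots w_{i_m}$ is order-isomorphic to $p$ (same relative order of entries); otherwise $w$ avoids $p$. $s_n(r_1,\dots,r_m)$ is the number of permutations of length $n$ avoiding all of the patterns $r_1,\dots,r_m$, and $a_n(r_1,\dots,r_m)$ is the number of alternating permutations of length $n$ avoiding all of the patterns $r_1,\dots,r_m$. *)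

(* Defs.v *)
From mathcomp Require Import all_boot.

Set Implicit Arguments.
Unset Strict Implicit.
Unset Printing Implicit Defensive.

(* A permutation of length n is the word w_1 ... w_n, a sequence in
   [permutations (iota 1 n)]. Entries are the integers 1, ..., n, while [nth]
   counts positions from 0: w_i is [nth 0 w i.-1]. *)

(* Comparing only strict inequalities is enough: the words considered here
   have pairwise distinct entries. *)
Definition order_isomorphic (u v : seq nat) : bool :=
  (size u == size v) &&
  [forall i : 'I_(size u), forall j : 'I_(size u),
     (nth 0 u i < nth 0 u j) == (nth 0 v i < nth 0 v j)].

Definition contains (w p : seq nat) : bool :=
  [exists t : (size p).-tuple 'I_(size w),
     sorted ltn [seq val i | i <- t] &&
     order_isomorphic [seq nth 0 w (val i) | i <- t] p].

Definition avoids (w p : seq nat) : bool := ~~ contains w p.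

(* w_1 < w_2 > w_3 < w_4 > ...; the parity test is reversed because of the
   0-based positions. *)
Definition alternating (w : seq nat) : bool :=
  [forall i : 'I_(size w).-1,
     if odd i then nth 0 w i.+1 < nth 0 w i else nth 0 w i < nth 0 w i.+1].

Definition num_avoiding (n : nat) (ps : seq (seq nat)) : nat :=
  count (fun w => all (avoids w) ps) (permutations (iota 1 n)).

Definition num_alternating_avoiding (n : nat) (ps : seq (seq nat)) : nat :=
  count (fun w => alternating w && all (avoids w) ps)
        (permutations (iota 1 n)).

(* k (k-1) ... 2 1 *)
Definition decreasing_pattern (k : nat) : seq nat := rev (iota 1 k).

(* (2k-1) (2k) (2k-3) (2k-2) ... 3 4 1 2 *)
Definition paired_pattern (k : nat) : seq nat :=
  flatten [seq [:: j.*2.-1; j.*2] | j <- rev (iota 1 k)].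

(* Main.v *)
Require Import Defs.
From mathcomp Require Import all_boot zify.

(* A nonempty 132-avoiding word is L m R with m its maximum and every entry of L above
   every entry of R, so these words are encoded by binary trees. Odd alternating words
   have the same decomposition, with L and R again odd alternating, except that they end
   at one-letter words instead of the empty word. An increasing block of length 2
   (resp. 1) cannot use entries of both L m and R, and if it uses m, then it
   is the only block inside L m. Hence the largest number of blocks satisfies
   h(L m R) = max(1, h(L)) + h(R) in both cases, and both sides count the trees with n
   nodes and h < k. *)

Set Implicit Arguments.
Unset Strict Implicit.
Unset Printing Implicit Defensive.

(** * Pattern containment through subsequences *)

Lemma order_isomorphicP u v :
  reflect (size u = size v /\ forall i j, i < size u -> j < size u ->
             (nth 0 u i < nth 0 u j) = (nth 0 v i < nth 0 v j))
          (order_isomorphic u v).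
Proof.
apply: (iffP andP) => [[/eqP suv /'forall_forallP uv]|[suv uv]].
  split=> // i j lti ltj.
  by have /eqP := uv (Ordinal lti) (Ordinal ltj).
split; first exact/eqP.
by apply/'forall_forallP => i j; apply/eqP; apply: uv.
Qed.

(** Trades tuples of positions for subsequences, which split well along a concatenation. *)
Lemma containsP w p :
  reflect (exists2 s, subseq s w & order_isomorphic s p) (contains w p).
Proof.
apply: (iffP existsP) => [[t /andP[t_sorted iso]]|[s /subseqP[m szm ->] iso]].
  exists [seq nth 0 w (val i) | i <- t] => //.
  rewrite map_comp -[in X in subseq _ X](mkseq_nth 0 w); apply: map_subseq.
  set r := map _ _ in t_sorted *.
  (* A strictly increasing list is determined by its members, so [r] is a filter, hence a
     subsequence, of all positions. *)
  have -> : r = [seq i <- iota 0 (size w) | i \in r].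
    apply: (irr_sorted_eq ltn_trans ltnn) => //.
      by apply: sorted_filter (iota_ltn_sorted _ _); apply: ltn_trans.
    move=> i; rewrite mem_filter mem_iota /= add0n.
    by case: (boolP (i \in r)) => // /mapP[j _ ->]; rewrite ltn_ord.
  exact: filter_subseq.
(* The mask that cuts the occurrence out of [w], applied to the list of all positions, gives the
   required tuple of indices. *)
have /eqP szp : size (mask m (enum 'I_(size w))) == size p.
  case/andP: iso => /eqP <- _.
  by rewrite !size_mask ?size_enum_ord.
exists (tcast szp (in_tuple _)).
rewrite val_tcast /= map_mask val_enum_ord.
apply/andP; split.
  by apply: (subseq_sorted ltn_trans (mask_subseq _ _)); apply: iota_ltn_sorted.
by rewrite (map_comp (nth 0 w) val) map_mask val_enum_ord map_mask -/(mkseq _ _) mkseq_nth.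
Qed.

Lemma contains_subseq v w p : subseq v w -> contains v p -> contains w p.
Proof.
move=> vw /containsP[s sv iso]; apply/containsP; exists s => //.
exact: subseq_trans vw.
Qed.

Lemma avoids_subseq v w p : subseq v w -> avoids w p -> avoids v p.
Proof. by move=> vw; apply: contra; apply: contains_subseq. Qed.

Lemma contains132P w :
  reflect (exists a b c, subseq [:: a; c; b] w /\ a < b < c)
          (contains w [:: 1; 3; 2]).
Proof.
apply: (iffP (containsP _ _)) => [[s sw /order_isomorphicP[]]|[a [b [c [sw abc]]]]].
  case: s sw => [|a [|c [|b []]]] //= sw _ iso.
  exists a, b, c; split=> //.
  by rewrite (iso 0 2) // (iso 2 1).
exists [:: a; c; b] => //; apply/order_isomorphicP; split=> //.
case=> [|[|[|i]]] //; case=> [|[|[|j]]] //=; lia.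
Qed.

(** * Skew sums of increasing blocks *)

Lemma nth_cat_add (T : Type) (x0 : T) s1 s2 n i :
  size s1 = n -> nth x0 (s1 ++ s2) (n + i) = nth x0 s2 i.
Proof. by move<-; rewrite nth_cat ltnNge leq_addr /= addKn. Qed.

Lemma allrel_nthP (r : rel nat) (s1 s2 : seq nat) :
  reflect (forall i j, i < size s1 -> j < size s2 -> r (nth 0 s1 i) (nth 0 s2 j))
          (allrel r s1 s2).
Proof.
apply: (iffP allrelP) => [s12 i j lti ltj|s12 x y].
  by apply: s12; apply: mem_nth.
by move=> /(nthP 0)[i lti <-] /(nthP 0)[j ltj <-]; apply: s12.
Qed.

(** Comparisons within each part give the two smaller isomorphisms; those across the cut are all
    decided by [v1] lying above [v2]. *)
Lemma order_isomorphic_skew u1 u2 v1 v2 :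
    size u1 = size v1 -> allrel gtn v1 v2 ->
  order_isomorphic (u1 ++ u2) (v1 ++ v2) =
  [&& order_isomorphic u1 v1, allrel gtn u1 u2 & order_isomorphic u2 v2].
Proof.
move=> sz1 /allrel_nthP/= v12; apply/order_isomorphicP/and3P.
  rewrite !size_cat => -[sz iso].
  have sz2 : size u2 = size v2 by lia.
  split.
  - apply/order_isomorphicP; split=> // i j lti ltj.
    have := iso i j; rewrite !nth_cat -sz1 lti ltj; apply; lia.
  - apply/allrel_nthP => i j lti ltj /=.
    have := iso (size u1 + j) i; rewrite !nth_cat_add // !nth_cat -sz1 lti.
    by move=> ->; rewrite ?v12; lia.
  - apply/order_isomorphicP; split=> // i j lti ltj.
    have := iso (size u1 + i) (size u1 + j).
    by rewrite !nth_cat_add //; apply; lia.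
move=> [/order_isomorphicP[_ iso1] /allrel_nthP/= u12 /order_isomorphicP[sz2 iso2]].
split; first by rewrite !size_cat sz1 sz2.
move=> i j; rewrite size_cat => lti ltj; rewrite !nth_cat -sz1.
case: (ltnP i) => [i1|i2]; case: (ltnP j) => [j1|j2].
- exact: iso1.
- have := u12 i (j - size u1); have := v12 i (j - size u1); lia.
- have := u12 j (i - size u1); have := v12 j (i - size u1); lia.
- by apply: iso2; lia.
Qed.

Lemma order_isomorphic_iota u x b :
  order_isomorphic u (iota x b) = (size u == b) && sorted ltn u.
Proof.
apply/order_isomorphicP/andP; rewrite size_iota => -[].
  move=> szu iso; split; first exact/eqP.
  suff inc i : i.+1 < size u -> nth 0 u i < nth 0 u i.+1 by apply/(sortedP 0).
  by move=> lti; rewrite iso ?nth_iota; lia.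
move=> /eqP szu u_sorted; split=> // i j lti ltj.
have inc i' j' : j' < size u -> i' < j' -> nth 0 u i' < nth 0 u j'.
  move=> ltj' ij; apply: (sorted_ltn_nth ltn_trans 0 u_sorted) => //.
  exact: ltn_trans ij ltj'.
have := inc i j ltj; have := inc j i lti.
rewrite !nth_iota -?szu // ltn_add2l.
case: (ltngtP i j) => [_ _|_ /(_ isT)|-> _ _]; [|lia|lia].
by move/(_ isT).
Qed.

Lemma dropl_cat (T : Type) n (s1 s2 : seq T) :
  n <= size s1 -> drop n (s1 ++ s2) = drop n s1 ++ s2.
Proof.
by rewrite drop_cat; case: ltngtP => // -> _; rewrite subnn drop0 drop_size.
Qed.

(** A test, block by block, for order isomorphism with the skew sum of [k] increasing blocks of
    length [b]. *)
Fixpoint layered b k s :=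
  if k is k'.+1 then
    [&& b <= size s, sorted ltn (take b s), allrel gtn (take b s) (drop b s)
      & layered b k' (drop b s)]
  else nilp s.

(** One family for both patterns of the theorem: [b = 1] gives the decreasing one, [b = 2] the
    paired one. *)
Fixpoint layered_pattern b k :=
  if k is k'.+1 then iota (k' * b).+1 b ++ layered_pattern b k' else [::].

Lemma decreasing_patternE k : decreasing_pattern k = layered_pattern 1 k.
Proof.
elim: k => //= k <-; rewrite /decreasing_pattern -[k.+1]addn1 iotaD rev_cat.
by rewrite add1n muln1.
Qed.

Lemma paired_patternE k : paired_pattern k = layered_pattern 2 k.
Proof.
elim: k => //= k <-; rewrite /paired_pattern -[k.+1]addn1 iotaD rev_cat /=.
by rewrite add1n muln2.
Qed.

Lemma layered_pattern_le b k x : x \in layered_pattern b k -> x <= k * b.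
Proof.
elim: k => //= k IHk; rewrite mem_cat mem_iota => /orP[|/IHk]; lia.
Qed.

Lemma size_layered_pattern b k : size (layered_pattern b k) = k * b.
Proof. by elim: k => //= k IHk; rewrite size_cat size_iota IHk mulSn. Qed.

Lemma order_isomorphic_layered b k s :
  order_isomorphic s (layered_pattern b k) = layered b k s.
Proof.
elim: k s => [|k IHk] s.
  by apply/order_isomorphicP/nilP => [[/size0nil]|->].
case: (leqP b (size s)) => [lebs|ltsb] /=; last first.
  rewrite leqNgt ltsb; apply/negP => /andP[/eqP].
  by rewrite size_cat size_iota size_layered_pattern; lia.
rewrite lebs -{1}(cat_take_drop b s) order_isomorphic_skew.
- by rewrite order_isomorphic_iota IHk size_takel // eqxx.
- by rewrite size_iota size_takel.
apply/allrelP => x y /=; rewrite mem_iota => /andP[lx _] /layered_pattern_le.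
by move/leq_ltn_trans; apply.
Qed.

(* A block cannot straddle the cut: it would contain a descent. *)
Lemma layered_cat b k s1 s2 : 0 < b -> allrel gtn s1 s2 ->
  reflect (exists i j, [/\ k = i + j, layered b i s1 & layered b j s2])
          (layered b k (s1 ++ s2)).
Proof.
move=> b_gt0 s12; apply: (iffP idP).
  elim: k s1 s2 s12 => [|k IHk] s1 s2 s12.
    by case: s1 s12 => //; case: s2 => // _ _; exists 0, 0.
  case: (posnP (size s1)) => [/size0nil->|s1_gt0].
    by exists 0, k.+1.
  case: (leqP b (size s1)) => [leb|ltb] /= /and4P[].
    rewrite takel_cat //.
    rewrite dropl_cat // allrel_catr => _ inc /andP[gt _] /IHk[|i [j [-> lay1 lay2]]].
      by move: s12; rewrite -{1}(cat_take_drop b s1) allrel_catl => /andP[].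
    by exists i.+1, j; rewrite addSn /= leb inc gt.
  rewrite size_cat take_cat ltnNge (ltnW ltb) /=.
  case: s1 s12 s1_gt0 ltb => // x s1 s12 _ ltb.
  case: s2 s12 => [|y s2] s12 lesz; first by rewrite /= in ltb lesz *; lia.
  have [d ->] : exists d, b - size (x :: s1) = d.+1 by exists (b - size (x :: s1)).-1; lia.
  rewrite /= cat_path /= => /and3P[_ lt_xy _].
  move/allrelP: s12 => /(_ (last x s1) y); rewrite mem_last mem_head /=.
  by move/(_ isT isT); lia.
move=> [i [j [-> + lay2]]]; elim: i s1 s12 => [|i IHi] s1 s12 /=.
  by move/nilP->.
move=> /and4P[lesz inc gt lay1].
have [take_s12 drop_s12] : allrel gtn (take b s1) s2 /\ allrel gtn (drop b s1) s2.
  by apply/andP; rewrite -allrel_catl cat_take_drop.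
rewrite size_cat (leq_trans lesz (leq_addr _ _)) takel_cat // inc /=.
by rewrite dropl_cat // allrel_catr gt take_s12 IHi.
Qed.

Lemma subseq_catP (s t1 t2 : seq nat) :
  reflect (exists s1 s2, [/\ s = s1 ++ s2, subseq s1 t1 & subseq s2 t2])
          (subseq s (t1 ++ t2)).
Proof.
apply: (iffP idP) => [/subseqP[m]|[s1 [s2 [-> st1 st2]]]]; last exact: cat_subseq.
rewrite size_cat -(cat_take_drop (size t1) m) => szm ->.
have sz1 : size (take (size t1) m) = size t1.
  by move: szm; rewrite cat_take_drop => szm; rewrite size_takel ?szm ?leq_addr.
rewrite mask_cat //; do 2!eexists; split; first by []; exact: mask_subseq.
Qed.

Lemma contains_layeredP w b k :
  reflect (exists2 s, subseq s w & layered b k s)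
          (contains w (layered_pattern b k)).
Proof.
apply: (iffP (containsP _ _)) => -[s sw lay]; exists s => //.
  by rewrite -order_isomorphic_layered.
by rewrite order_isomorphic_layered.
Qed.

Lemma allrel_subset (T S : eqType) (r : T -> S -> bool) s1 t1 s2 t2 :
  {subset s1 <= t1} -> {subset s2 <= t2} -> allrel r t1 t2 -> allrel r s1 s2.
Proof.
move=> st1 st2 /allrelP rt; apply/allrelP => x y /st1 xt /st2 yt; exact: rt.
Qed.

(** Makes the largest number of blocks additive: an occurrence splits at the cut, and no block
    straddles it. *)
Lemma contains_layered_cat w1 w2 b k : 0 < b -> allrel gtn w1 w2 ->
  reflect (exists i j, [/\ k = i + j, contains w1 (layered_pattern b i)
                         & contains w2 (layered_pattern b j)])
          (contains (w1 ++ w2) (layered_pattern b k)).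
Proof.
move=> b_gt0 w12; apply: (iffP (contains_layeredP _ _ _)).
  move=> [_ /subseq_catP[s1 [s2 [-> sw1 sw2]]] /layered_cat[] //].
    exact: allrel_subset (mem_subseq sw1) (mem_subseq sw2) w12.
  move=> i [j [-> lay1 lay2]]; exists i, j.
  by split=> //; apply/contains_layeredP; [exists s1 | exists s2].
move=> [i [j [-> /contains_layeredP[s1 sw1 lay1] /contains_layeredP[s2 sw2 lay2]]]].
exists (s1 ++ s2); first exact: cat_subseq.
apply/layered_cat => //; last by exists i, j.
exact: allrel_subset (mem_subseq sw1) (mem_subseq sw2) w12.
Qed.

(* A final maximum can only lie in the first block, so it ends that block. *)
Lemma contains_layered_rcons w m b k : 0 < b -> all (gtn m) w ->
  contains (rcons w m) (layered_pattern b k) ->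
  contains w (layered_pattern b k) \/ k = 1.
Proof.
move=> b_gt0 /allP w_lt /contains_layeredP[s].
rewrite -cats1 => /subseq_catP[s1 [s2 [-> sw1]]].
case: s2 => [_|x s2].
  by rewrite cats0 => lay; left; apply/contains_layeredP; exists s1.
rewrite /=; case: (x =P m) => // -> /eqP->.
case: k => [|[|k]] /=; [by case: s1 {sw1} | by right |].
rewrite size_drop size_cat /= => /and4P[_ _ gt /andP[lesz _]].
have leb : b <= size s1 by lia.
move: gt; rewrite takel_cat // dropl_cat //.
case: s1 sw1 {lesz} leb => [|y s1] sw1; first by rewrite leqNgt b_gt0.
case: b b_gt0 => // b _ _; rewrite /= allrel_catr => /andP[_ /= /andP[]].
have /= lt_ym := w_lt _ (mem_subseq sw1 (mem_head _ _)).
by rewrite ltnNge (ltnW lt_ym).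
Qed.

(** * Binary trees and the words they encode *)

Inductive tree := Leaf | Node of tree & tree.

Fixpoint nodes t := if t is Node l r then (nodes l + nodes r).+1 else 0.

(** Not the depth: this is the largest number of blocks of length [c.+1] in the word of [t], and it
    does not depend on [c]. *)
Fixpoint height t := if t is Node l r then maxn 1 (height l) + height r else 0.

(** With n nodes there are n + 1 leaves of [c] letters each, and every node adds one letter. *)
Definition word_size c t := c + c.+1 * nodes t.

(* The words on lo+1, lo+2, ... with leaves of length c: 132-avoiding words for c = 0,
   alternating 132-avoiding words of odd length for c = 1. *)
Fixpoint word c lo t :=
  if t is Node l r then
    word c (lo + word_size c r) l
      ++ (lo + word_size c r + word_size c l).+1 :: word c lo r
  else iota lo.+1 c.

Lemma word_size_Node c l r :
  word_size c (Node l r) = (word_size c r + word_size c l).+1.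
Proof. by rewrite /word_size /=; lia. Qed.

Lemma perm_word c lo t : perm_eq (word c lo t) (iota lo.+1 (word_size c t)).
Proof.
elim: t lo => [|l IHl r IHr] lo /=; first by rewrite /word_size muln0 addn0.
rewrite word_size_Node -[(word_size c r + _).+1]addn1 iotaD [iota _ (word_size c r + _)]iotaD !addSn addnA /=.
have /permP IHl' := IHl (lo + word_size c r); have /permP IHr' := IHr lo.
by apply/permP => p; rewrite !count_cat /= IHl' IHr' addn0 addnC -addnA addnC.
Qed.

Lemma size_word c lo t : size (word c lo t) = word_size c t.
Proof. by rewrite (perm_size (perm_word c lo t)) size_iota. Qed.

Lemma mem_word c lo t x : (x \in word c lo t) = (lo < x <= lo + word_size c t).
Proof. by rewrite (perm_mem (perm_word c lo t)) mem_iota addSn ltnS. Qed.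

Lemma allrel_word c lo l r :
  allrel gtn (word c (lo + word_size c r) l) (word c lo r).
Proof. by apply/allrelP => x y; rewrite !mem_word /=; lia. Qed.

Lemma all_word_lt c lo t m : lo + word_size c t < m -> all (gtn m) (word c lo t).
Proof. by move=> ltm; apply/allP => x; rewrite mem_word /=; lia. Qed.

(** The leftmost leaf provides the run; a maximum placed after it completes a block of length
    [c.+1]. *)
Lemma word_subseq c lo t : exists x, subseq (iota x c) (word c lo t).
Proof.
elim: t lo => [|l IHl r _] lo; first by exists lo.+1.
have [x xl] := IHl (lo + word_size c r); exists x.
exact: subseq_trans xl (prefix_subseq _ _).
Qed.

Lemma contains_word c lo t k :
  contains (word c lo t) (layered_pattern c.+1 k) = (k <= height t).
Proof.
elim: t lo k => [|l IHl r IHr] lo k.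
  (* A leaf has [c] letters, too few for even one block of length [c.+1]. *)
  rewrite leqn0; apply/contains_layeredP/eqP => [[s /size_subseq]|->].
    by case: k => //= k; rewrite size_iota => les /andP[]; rewrite ltnNge les.
  by exists [::] => //; apply: sub0seq.
(* The maximum is grouped with the left word, so that everything before the cut lies above
   everything after it. *)
rewrite [word _ _ _]/= -cat_rcons.
set m := (_ + word_size c l).+1; set L := word _ _ l.
have L_lt : all (gtn m) L by apply: all_word_lt.
have gt_r : allrel gtn (rcons L m) (word c lo r).
  rewrite -cats1 allrel_catl allrel_word allrel1l.
  by apply/allP => x; rewrite mem_word /= /m; lia.
have one : contains (rcons L m) (layered_pattern c.+1 1).
  have [x xL] := word_subseq c (lo + word_size c r) l.
  apply/containsP; exists (rcons (iota x c) m).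
    by rewrite -!cats1 cat_subseq.
  rewrite [layered_pattern _ _]cats0 order_isomorphic_iota size_rcons size_iota eqxx.
  rewrite (sorted_pairwise ltn_trans) pairwise_rcons -(sorted_pairwise ltn_trans).
  rewrite iota_ltn_sorted andbT; apply/allP => y /(mem_subseq xL).
  exact: (allP L_lt).
apply/contains_layered_cat/idP => // [[i [j [-> ci]]]|lek] /=.
  rewrite IHr => lej; case: (contains_layered_rcons _ L_lt ci) => //.
    by rewrite IHl; lia.
  by move=> ->; lia.
(* As many blocks as possible are taken from the left; the truncated difference is 0 when these
   suffice. *)
exists (minn k (maxn 1 (height l))), (k - maxn 1 (height l)); split.
- by rewrite minnE subnK // leq_subr.
(* More blocks than [height l] are asked for only when [height l = 0]; then a single block is
   needed, and [one] supplies it. *)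
- case: (leqP (minn k (maxn 1 (height l))) (height l)) => [lel|gtl].
    apply: contains_subseq (subseq_rcons _ _) _; rewrite IHl; lia.
  by have -> : minn k (maxn 1 (height l)) = 1 by lia.
by rewrite IHr leq_subLR.
Qed.

(** * 132-avoidance and alternation around the maximum *)

Lemma avoids132_cat L m R :
    all (gtn m) L -> all (gtn m) R -> allrel gtn L R ->
    avoids L [:: 1; 3; 2] -> avoids R [:: 1; 3; 2] ->
  avoids (L ++ m :: R) [:: 1; 3; 2].
Proof.
move=> /allP/= L_lt /allP/= R_lt /allrelP/= LR avL avR.
apply/contains132P => -[a [b [c [/subseq_catP[s1 [s2 [defs sL sR]]] abc]]]].
have sub1 := mem_subseq sL; have sub2 x : x \in s2 -> (x == m) || (x \in R).
  by move/(mem_subseq sR); rewrite in_cons.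
case: s1 defs sL sub1 => [/= defs|x s1 /= [<- defs]] sL sub1.
  move: sR sub2; rewrite -defs /=; case: eqP => [am _ /(_ b)|_ sR _].
    by rewrite !inE eqxx !orbT => /(_ isT) /orP[/eqP|/R_lt]; lia.
  by case/negP: avR; apply/contains132P; exists a, b, c.
(* Once [a] is in [L], all of [R] lies below [a], so a [b] outside [L] must be [m]; then [c] would
   exceed the maximum. *)
have bm : b \in m :: R -> b = m.
  rewrite inE => /predU1P[//|/(LR a)]; rewrite sub1 ?mem_head // => /(_ isT); lia.
case: s1 defs sL sub1 => [/= defs|y s1 /= [<- defs]] sL sub1.
  have eb : b = m by apply/bm/sub2; rewrite -defs !inE eqxx orbT.
  have : c \in s2 by rewrite -defs mem_head.
  by move/sub2 => /orP[/eqP|/R_lt]; lia.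
case: s1 defs sL sub1 => [/= defs|z s1 /= [<- defs]] sL sub1.
  have eb : b = m by apply/bm/sub2; rewrite -defs mem_head.
  have /L_lt : c \in L by rewrite sub1 // !inE eqxx orbT.
  by lia.
case: s1 defs sL {sub1} => // _ sL; case/negP: avL.
by apply/contains132P; exists a, b, c.
Qed.

(** A letter x of [L] below a letter y of [R] would form the occurrence x m y of 132. *)
Lemma avoids132_catP L m R :
    uniq (L ++ m :: R) -> all (gtn m) L -> all (gtn m) R ->
    avoids (L ++ m :: R) [:: 1; 3; 2] ->
  [/\ allrel gtn L R, avoids L [:: 1; 3; 2] & avoids R [:: 1; 3; 2]].
Proof.
rewrite cat_uniq => /and3P[_ /hasPn/= notL _] /allP/= L_lt /allP/= R_lt av; split.
- apply/allrelP => x y xL yR /=; rewrite ltnNge leq_eqVlt; apply/negP => /orP[/eqP xy|lt_xy].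
    by have /negP[] : y \notin L by [apply: notL; rewrite inE yR orbT]; rewrite -xy.
  case/negP: av; apply/contains132P; exists x, y, m; split.
    by rewrite (cat_subseq (s1 := [:: x]) (s2 := [:: m; y])) ?sub1seq //= eqxx sub1seq.
  by rewrite lt_xy /=; apply: R_lt.
- exact: avoids_subseq (prefix_subseq _ _) av.
- by apply: avoids_subseq av; rewrite -cat_rcons suffix_subseq.
Qed.

Lemma alternatingP w :
  reflect (forall i, i.+1 < size w ->
             if odd i then nth 0 w i.+1 < nth 0 w i else nth 0 w i < nth 0 w i.+1)
          (alternating w).
Proof.
apply: (iffP forallP) => alt i; last by apply: alt; have := ltn_ord i; lia.
move=> lti; have lti' : i < (size w).-1 by lia.
exact: alt (Ordinal lti').
Qed.

Lemma nth_pivot (T : Type) (x0 x : T) s1 s2 : nth x0 (s1 ++ x :: s2) (size s1) = x.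
Proof. by rewrite nth_cat ltnn subnn. Qed.

(** The maximum must be a peak, and peaks sit at odd positions counted from 0; the only exception is
    a one-letter word, excluded by the size hypothesis. *)
Lemma alternating_max_odd L m R :
    alternating (L ++ m :: R) -> all (gtn m) L -> all (gtn m) R ->
    0 < size L + size R -> odd (size L).
Proof.
move=> /alternatingP alt /allP/= L_lt /allP/= R_lt sz_gt0.
apply: contraLR sz_gt0 => evenL; rewrite lt0n negbK addn_eq0.
apply/andP; split; rewrite -leqn0 leqNgt; apply/negP => sz_gt0.
  have ltL : (size L).-1 < size L by lia.
  have := alt (size L).-1; rewrite prednK // nth_pivot nth_cat ltL.
  have -> : odd (size L).-1 by lia.
  have := L_lt _ (mem_nth 0 ltL); rewrite size_cat /=; lia.
have := alt (size L); rewrite (negPf evenL) nth_pivot -[(size L).+1]addn1 nth_cat_add //=.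
have := R_lt _ (mem_nth 0 sz_gt0); rewrite size_cat /=; lia.
Qed.

(** The comparisons with [m] hold because it is the maximum at an odd position, and [R] starts at an
    even position, so its parities are unchanged. *)
Lemma alternating_catP L m R :
    odd (size L) -> all (gtn m) L -> all (gtn m) R ->
  alternating (L ++ m :: R) = alternating L && alternating R.
Proof.
move=> oddL /allP/= L_lt /allP/= R_lt.
have nthL i : i < size L -> nth 0 (L ++ m :: R) i = nth 0 L i.
  by rewrite nth_cat => ->.
have nthm : nth 0 (L ++ m :: R) (size L) = m.
  exact: nth_pivot.
have nthR i : nth 0 (L ++ m :: R) (size L + i.+1) = nth 0 R i.
  by rewrite nth_cat_add.
apply/alternatingP/andP => [alt|[/alternatingP altL /alternatingP altR] i].
  split; apply/alternatingP => i lti.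
    by have := alt i; rewrite !nthL ?(ltnW lti) // size_cat; apply; lia.
  have := alt (size L + i.+1); rewrite -addnS !nthR oddD oddL /= negbK.
  by rewrite size_cat /=; apply; lia.
rewrite size_cat /= => lti; case: (ltngtP i.+1 (size L)) => [ltiL|gtiL|eqiL].
- by rewrite !nthL ?(ltnW ltiL) //; apply: altL.
- case: (ltngtP i (size L)) => [|{}gtiL|eqiL]; first by lia.
    have [j ej] : exists j, i = size L + j.+1 by exists (i - size L).-1; lia.
    rewrite ej -addnS !nthR oddD oddL /= negbK; apply: altR; lia.
  rewrite eqiL oddL -[X in nth 0 _ X < _]addn1 nthR nthm.
  by have R_gt0 : 0 < size R by [lia]; apply: R_lt (mem_nth 0 R_gt0).
have ltiL : i < size L by lia.
rewrite eqiL nthm nthL // (_ : odd i = false); last by lia.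
exact: L_lt (mem_nth 0 ltiL).
Qed.

Lemma avoids132_word c lo t : c <= 1 -> avoids (word c lo t) [:: 1; 3; 2].
Proof.
move=> c_le1; elim: t lo => [|l IHl r IHr] lo /=.
  apply: contraL c_le1 => /contains132P[a [b [d [/size_subseq]]]].
  by rewrite size_iota -ltnNge => /ltnW.
by apply: avoids132_cat => //; do ?apply: all_word_lt; try exact: allrel_word; lia.
Qed.

Lemma alternating_word lo t : alternating (word 1 lo t).
Proof.
elim: t lo => [|l IHl r IHr] lo /=; first by apply/alternatingP; case.
rewrite alternating_catP ?IHl ?IHr //.
- by rewrite size_word /word_size; lia.
- exact: all_word_lt.
- by apply: all_word_lt; lia.
Qed.

(** Sorting [R] and [L] separately and appending [m] already yields a sorted word, hence the whole
    interval; its three segments are then read off. *)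
Lemma perm_iota_split lo N L m R :
    perm_eq (L ++ m :: R) (iota lo.+1 N) -> all (gtn m) L -> allrel gtn L R ->
    all (gtn m) R ->
  [/\ perm_eq R (iota lo.+1 (size R)),
      perm_eq L (iota (lo + size R).+1 (size L))
    & m = (lo + size R + size L).+1].
Proof.
move=> w_iota /allP/= L_lt /allrelP/= LR /allP/= R_lt.
have szN : N = size R + (size L + 1).
  by rewrite -(size_iota lo.+1 N) -(perm_size w_iota) size_cat /=; lia.
have : sort leq R ++ sort leq L ++ [:: m] = iota lo.+1 N.
  apply: (sorted_eq leq_trans anti_leq).
  - rewrite (sorted_pairwise leq_trans) !pairwise_cat.
    rewrite -!(sorted_pairwise leq_trans) !(sort_sorted leq_total) /= !andbT.
    apply/andP; split; apply/allrelP => x y; rewrite ?mem_cat !mem_sort => xin.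
      by case/orP=> [yL|]; [apply: ltnW (LR _ _ yL xin) | rewrite inE => /eqP->; apply: ltnW (R_lt _ xin)].
    by rewrite inE => /eqP->; apply: ltnW (L_lt _ xin).
  - exact: iota_sorted.
  apply: perm_trans w_iota.
  rewrite perm_sym -cat1s catA perm_catC.
  by apply: perm_cat; [|apply: perm_cat]; rewrite // perm_sym perm_sort.
rewrite szN !iotaD => /eqP.
rewrite eqseq_cat ?size_sort ?size_iota // => /andP[/eqP eR].
rewrite eqseq_cat ?size_sort ?size_iota // => /andP[/eqP eL /eqP[->]].
split; last by rewrite !addSn.
- by rewrite -eR perm_sym perm_sort.
- by rewrite -addSn -eL perm_sym perm_sort.
Qed.

(** * Each word comes from exactly one tree *)

(** Both sides of the maximum again have the size of a tree word: for [c = 1] the total is odd, so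
    an odd [x] forces an odd [y]. *)
Lemma split_word_size (c : bool) n x y :
    x + y.+1 = c + c.+1 * n.+1 -> (c -> odd x) ->
  exists i j, [/\ x = c + c.+1 * i, y = c + c.+1 * j & n = i + j].
Proof.
case: c => /= [xy /(_ isT) odd_x|xy _]; last by exists x, y; split; lia.
exists x./2, y./2; split; lia.
Qed.

(** Strong induction on the number of nodes: cutting at the maximum leaves two shorter words of the
    same kind on consecutive intervals of values. *)
Lemma word_exists (c : bool) lo n w :
    perm_eq w (iota lo.+1 (c + c.+1 * n)) -> avoids w [:: 1; 3; 2] ->
    (c -> alternating w) ->
  exists2 t, nodes t = n & word c lo t = w.
Proof.
elim/ltn_ind: n lo w => n IHn lo w w_iota av alt.
case: n => [|n] in IHn w_iota *.
  exists Leaf => //=; rewrite (perm_small_eq _ w_iota) muln0 addn0 //.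
  by rewrite size_iota; case: c {alt w_iota IHn}.
set N := c + _ in w_iota.
have mem_w x : (x \in w) = (lo < x <= lo + N).
  by rewrite (perm_mem w_iota) mem_iota addSn ltnS.
have uniq_w : uniq w by rewrite (perm_uniq w_iota) iota_uniq.
have szw : size w = N by rewrite (perm_size w_iota) size_iota.
have : lo + N \in w by rewrite mem_w /N; lia.
move: (lo + N) mem_w => m mem_w /splitPr def_w.
case: w / def_w => L R in w_iota av alt mem_w uniq_w szw *.
have ltm x : x \in L ++ R -> x < m.
  move=> xLR; have : x \in L ++ m :: R.
    by move: xLR; rewrite !mem_cat inE orbCA => ->; rewrite orbT.
  rewrite mem_w => /andP[_]; rewrite leq_eqVlt => /predU1P[xm|//].
  by move: uniq_w; rewrite -cat1s uniq_catCA /= -xm xLR.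
have L_lt : all (gtn m) L by apply/allP => x xL; apply: ltm; rewrite mem_cat xL.
have R_lt : all (gtn m) R by apply/allP => x xR; apply: ltm; rewrite mem_cat xR orbT.
have [LR avL avR] := avoids132_catP uniq_w L_lt R_lt av.
have [R_iota L_iota def_m] := perm_iota_split w_iota L_lt LR R_lt.
rewrite size_cat /= /N in szw.
(* For [c = 1] the word has at least three letters, so the one-letter exception does not arise. *)
have oddL : c -> odd (size L).
  move=> hc; apply: alternating_max_odd (alt hc) L_lt R_lt _.
  by move: szw; rewrite hc; clear; lia.
have altLR : c -> alternating L && alternating R.
  by move=> hc; rewrite -(alternating_catP (oddL hc) L_lt R_lt) alt.
have [i [j [szL szR nij]]] := split_word_size szw oddL.
have [l nl wl] : exists2 t, nodes t = i & word c (lo + size R) t = L.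
  apply: IHn => //; first by rewrite nij ltnS leq_addr.
    by rewrite -szL.
  by case/altLR/andP.
have [r nr wr] : exists2 t, nodes t = j & word c lo t = R.
  apply: IHn => //; first by rewrite nij ltnS leq_addl.
    by rewrite -szR.
  by case/altLR/andP.
exists (Node l r); first by rewrite /= nl nr nij.
by rewrite /= /word_size nl nr -szL -szR wl wr -def_m.
Qed.

(** The length separates leaves from nodes, and the maximum, absent from the left word, marks the
    cut. Equal right words then give equal offsets for the left ones. *)
Lemma word_inj c lo : injective (word c lo).
Proof.
move=> t; elim: t lo => [|l IHl r IHr] lo [|l' r'] eq_w //.
- by have := congr1 size eq_w; rewrite !size_word word_size_Node /word_size /=; lia.
- by have := congr1 size eq_w; rewrite !size_word word_size_Node /word_size /=; lia.
have := congr1 size eq_w; rewrite !size_word !word_size_Node => -[sz_lr].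
have eq_m : lo + word_size c r' + word_size c l' = lo + word_size c r + word_size c l.
  by lia.
move: eq_w; rewrite /= eq_m; set m := (_ + word_size c l).+1 => eq_w.
have Nm : m \notin word c (lo + word_size c r) l by rewrite mem_word /m; lia.
have Nm' : m \notin word c (lo + word_size c r') l' by rewrite mem_word /m; lia.
have eq_l : word c (lo + word_size c r) l = word c (lo + word_size c r') l'.
  by rewrite -(take_pivot (word c lo r) Nm) eq_w take_pivot.
move: eq_w; rewrite eq_l => /eqP; rewrite eqseq_cat // eqxx eqseq_cons eqxx.
move=> /eqP eq_r; have e : word_size c r = word_size c r'.
  by rewrite -(size_word c lo r) eq_r size_word.
by rewrite (IHr _ _ eq_r) (IHl (lo + word_size c r) l') // eq_l e.
Qed.

(** * Comparison of the two counts *)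

(** Choosing a code for each element of [A] gives a list [s] in the bare type [T]; its image under
    [f] has no repetition, so neither has its image under the injective [g], which lies in [B]. *)
Lemma size_leq_encoding (T : Type) (U V : eqType) (f : T -> U) (g : T -> V) A B :
    injective g -> uniq A ->
    (forall a, a \in A -> exists2 t, f t = a & g t \in B) ->
  size A <= size B.
Proof.
move=> g_inj uA AB.
have [s def_A gB] : exists2 s, A = map f s & {subset map g s <= B}.
  elim: A {uA} AB => [|a A IHA] AB; first by exists [::].
  have [x xA|s -> gB] := IHA; first by apply: AB; rewrite inE xA orbT.
  have [t ft gt] := AB a (mem_head _ _); exists (t :: s); first by rewrite /= ft.
  by move=> y /=; rewrite inE => /predU1P[->|/gB].
rewrite def_A size_map -(size_map g); apply: uniq_leq_size gB.
move: uA; rewrite def_A; elim: s {def_A} => //= t s IHs /andP[Nt /IHs ->].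
rewrite andbT; apply: contra Nt.
elim: s {IHs} => //= t' s IHs; rewrite !inE => /orP[/eqP/g_inj->|/IHs->].
  by rewrite eqxx.
by rewrite orbT.
Qed.

(** [c] is at once the leaf length and the switch for alternation: [true] gives the left side of the
    theorem, [false] the right side. *)
Definition tree_words (c : bool) n k :=
  [seq w <- permutations (iota 1 (c + c.+1 * n))
     | (c ==> alternating w)
         && all (avoids w) [:: [:: 1; 3; 2]; layered_pattern c.+1 k]].

(** Avoidance of the layered pattern becomes [height t < k], the same condition on trees for both
    values of [c]. *)
Lemma tree_wordsP (c : bool) n k w :
  reflect (exists t, [/\ nodes t = n, height t < k & word c 0 t = w])
          (w \in tree_words c n k).
Proof.
rewrite mem_filter mem_permutations /= andbT.
apply: (iffP andP) => [[/and3P[/implyP alt av avk] w_iota]|[t [<- lt_k <-]]].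
  have [t nt wt] := word_exists w_iota av alt; exists t; split=> //.
  by move: avk; rewrite -wt /avoids contains_word -ltnNge.
split; last exact: perm_word.
rewrite avoids132_word ?leq_b1 // /avoids contains_word -ltnNge lt_k /= andbT.
by apply/implyP; case: c => // _; apply: alternating_word.
Qed.

Lemma size_tree_words_le (c d : bool) n k :
  size (tree_words c n k) <= size (tree_words d n k).
Proof.
apply: (size_leq_encoding (f := word c 0) (g := word d 0)).
- exact: word_inj.
- by rewrite filter_uniq // permutations_uniq.
move=> w /tree_wordsP[t [tn tk <-]]; exists t => //.
by apply/tree_wordsP; exists t.
Qed.

Theorem corollary4p4 (n k : nat) (hk : 2 <= k) :
  num_alternating_avoiding (2 * n + 1) [:: [:: 1; 3; 2]; paired_pattern k] =
  num_avoiding n [:: [:: 1; 3; 2]; decreasing_pattern k].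
Proof.
have -> : num_alternating_avoiding (2 * n + 1) [:: [:: 1; 3; 2]; paired_pattern k]
        = size (tree_words true n k).
  by rewrite addnC paired_patternE size_filter.
have -> : num_avoiding n [:: [:: 1; 3; 2]; decreasing_pattern k]
        = size (tree_words false n k).
  by rewrite decreasing_patternE -[n in LHS]mul1n size_filter.
(* Re-encoding the same trees works in both directions, which gives the two inequalities. *)
by apply/eqP; rewrite eqn_leq !size_tree_words_le.
Qed.
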